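(* Let $A,P\in\mathbb{R}^{n\times n}$ be invertible and $b\in\mathbb{R}^n$. Consider full NGMRES used to accelerate the preconditioned Richardson iteration $q(x)=x+P(b-Ax)$ for solving $g(x)=Ax-b=0$, and the right-preconditioned GMRES method with right preconditioner $P$ for solving $Ax=b$. Assume both methods use the same initial guess $x_0$. Let $\{x_i\}$ and $\{x_i^{Gr}\}$ be the sequences generated by full NGMRES and right-preconditioned GMRES, respectively, and let $\bar r_i^{Gr}=Ax_i^{Gr}-b$. Assume that for some $k^*\in\mathbb{Z}^+$, $\bar r^{Gr}_{k^*-1}\neq 0$ and $\|\bar r^{Gr}_k\|<\|\bar r^{Gr}_{k-1}\|$ for all $k\in\mathbb{Z}^+$ with $0<k<k^*$. Then $x_k=x_k^{Gr}$ for all $0\le k\le k^*$.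
   Context: $\|\cdot\|$ is the Euclidean 2-norm. Full NGMRES: given $x_0\in\mathbb{R}^n$, for $k=0,1,2,\dots$ set $$x_{k+1}=q(x_k)+\sum_{i=0}^{k}\beta_i^{(k)}\big(q(x_k)-x_{k-i}\big),$$ where $\boldsymbol{\beta}^{(k)}=(\beta_0^{(k)},\dots,\beta_k^{(k)})\in\mathbb{R}^{k+1}$ is a minimizer of $$\Big\|g(q(x_k))+\sum_{i=0}^{k}\beta_i^{(k)}\big(g(q(x_k))-g(x_{k-i})\big)\Big\|^2 .$$ Right-preconditioned GMRES with preconditioner $P$ and initial guess $x_0$: let $\bar r_0=Ax_0-b$ and $\mathcal{K}_k(AP,\bar r_0)=\mathrm{span}\{\bar r_0,AP\bar r_0,\dots,(AP)^{k-1}\bar r_0\}$. Then $x_0^{Gr}=x_0$ and, for $k\ge1$, $x_k^{Gr}=x_0+Pz_k$, where $z_k\in\mathcal{K}_k(AP,\bar r_0)$ minimizes $\|\bar r_0+APz\|$ over $z\in\mathcal{K}_k(AP,\bar r_0)$. *)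

(* Defs.v *)
From mathcomp Require Import all_boot all_order all_algebra.
From mathcomp Require Import reals.

Set Implicit Arguments.
Unset Strict Implicit.
Unset Printing Implicit Defensive.

Import Order.TTheory GRing.Theory Num.Theory.
Local Open Scope ring_scope.

(* The library norm `|v| on matrices is the max norm, hence this definition. *)
Definition norm2 (R : realType) (n : nat) (v : 'cV[R]_n) : R :=
  Num.sqrt (\sum_(i < n) v i 0 ^+ 2).

Definition minimizes (R : realType) (T : Type) (D : T -> Prop) (f : T -> R)
    (t : T) : Prop :=
  D t /\ forall s : T, D s -> f t <= f s.

Definition residual (R : realType) (n : nat) (A : 'M[R]_n) (b x : 'cV[R]_n) :
    'cV[R]_n :=
  A *m x - b.

Definition richardson (R : realType) (n : nat) (A P : 'M[R]_n)
    (b x : 'cV[R]_n) : 'cV[R]_n :=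
  x + P *m (b - A *m x).

(* Minimizers need not be unique for general g and q, so a run of the method
   is a relation: at each step beta may be any minimizer. *)
Definition full_NGMRES (R : realType) (n : nat) (g q : 'cV[R]_n -> 'cV[R]_n)
    (x0 : 'cV[R]_n) (x : nat -> 'cV[R]_n) : Prop :=
  x 0%N = x0 /\
  forall k : nat, exists beta : 'rV[R]_k.+1,
    minimizes (fun=> True)
      (fun c : 'rV[R]_k.+1 =>
         norm2 (g (q (x k)) +
           \sum_(i < k.+1) c 0 i *: (g (q (x k)) - g (x (k - i)%N))) ^+ 2)
      beta /\
    x k.+1 = q (x k) + \sum_(i < k.+1) beta 0 i *: (q (x k) - x (k - i)%N).

Definition krylov (R : realType) (n : nat) (M : 'M[R]_n) (r : 'cV[R]_n)
    (k : nat) : {vspace 'cV[R]_n} :=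
  <<mkseq (fun j => M ^+ j *m r) k>>%VS.

Definition right_GMRES (R : realType) (n : nat) (A P : 'M[R]_n)
    (b x0 : 'cV[R]_n) (x : nat -> 'cV[R]_n) : Prop :=
  x 0%N = x0 /\
  forall k : nat, (0 < k)%N -> exists z : 'cV[R]_n,
    minimizes (fun y => y \in krylov (A *m P) (residual A b x0) k)
      (fun y => norm2 (residual A b x0 + A *m P *m y)) z /\
    x k = x0 + P *m z.

(* Main.v *)
Require Import Defs.
From mathcomp Require Import all_boot all_order all_algebra.
From mathcomp Require Import reals ring.

Set Implicit Arguments.
Unset Strict Implicit.
Unset Printing Implicit Defensive.

Import Order.TTheory GRing.Theory Num.Theory.
Local Open Scope ring_scope.

(** Write M = AP, r0 for the initial residual, K_k for the k-th Krylov space,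
    and x = x0 + P z, so that the residual at x is r0 + M z and Richardson
    sends the coordinate z to z - (r0 + M z).  GMRES is then the minimization
    of |r0 + M z| over K_k; let z_k be its solution and r_k = r0 + M z_k.

    As long as the two methods have agreed up to step k, NGMRES minimizes the
    same function over the points w + sum_i c_i (w - z_(k-i)), where
    w = z_k - r_k.  All these points lie in K_(k+1), and since w does too,
    they fill K_(k+1) exactly when the directions w - z_j (j <= k) span it.
    As z_0 = 0, the span of the directions is that of r_k, z_1, ..., z_k, so
    what has to be seen is that each of these vectors adds a new dimension:

    - z_j is not in K_(j-1), because the residual norm strictly drops at
      step j ([gmres_step_notin]);
    - r_k is not in K_k ([gmres_residual_notin]).  For k = 0 this says that r0
      is nonzero.  For k > 0, suppose r_k is in K_k; then so is
      M z_k = r_k - r0.  As z_k has a nonzero component on the last Krylov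
      vector, K_k is stable under M, hence contains the exact solution of
      r0 + M y = 0, and GMRES would have reached r_k = 0.

    The two methods therefore minimize over the same space
    ([ngmres_directions_span]), and since M is injective and the Euclidean
    norm strictly convex, the minimizer is unique ([residual_minimizer_uniq]). *)

(** * Euclidean norm *)

Lemma norm2_ge0 (R : realType) (n : nat) (v : 'cV[R]_n) : 0 <= norm2 v.
Proof. exact: sqrtr_ge0. Qed.

Lemma norm2_sqr (R : realType) (n : nat) (v : 'cV[R]_n) :
  norm2 v ^+ 2 = \sum_(i < n) v i 0 ^+ 2.
Proof. by rewrite /norm2 sqr_sqrtr // sumr_ge0 // => i _; rewrite sqr_ge0. Qed.

Lemma norm2_eq0 (R : realType) (n : nat) (v : 'cV[R]_n) :
  (norm2 v == 0) = (v == 0).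
Proof.
apply/eqP/eqP => [v0|->]; last first.
  by rewrite /norm2 big1 ?sqrtr0 // => i _; rewrite mxE expr0n.
have := norm2_sqr v; rewrite v0 expr0n /= => /esym/eqP.
rewrite psumr_eq0 => [/allP s0|i _]; last exact: sqr_ge0.
apply/matrixP=> i j; rewrite ord1 mxE; apply/eqP.
by have := s0 i (mem_index_enum i); rewrite sqrf_eq0.
Qed.

Lemma norm2_parallelogram (R : realType) (n : nat) (u v : 'cV[R]_n) :
  norm2 (2^-1 *: (u + v)) ^+ 2 *+ 4 + norm2 (u - v) ^+ 2 =
  (norm2 u ^+ 2 + norm2 v ^+ 2) *+ 2.
Proof.
rewrite !norm2_sqr -big_split /= -!sumrMnl -big_split /=.
by apply: eq_bigr => i _; rewrite !mxE; field.
Qed.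

(** Two minimizers have the same residual, as otherwise the residual at their
    midpoint would be strictly shorter; injectivity of [M] does the rest. *)
Lemma residual_minimizer_uniq (R : realType) (n : nat) (M : 'M[R]_n)
    (r : 'cV[R]_n) (V : {vspace 'cV[R]_n}) (u v : 'cV[R]_n) :
  M \in unitmx ->
  minimizes (fun y => y \in V) (fun y => norm2 (r + M *m y)) u ->
  minimizes (fun y => y \in V) (fun y => norm2 (r + M *m y)) v ->
  u = v.
Proof.
move=> hM [uV umin] [vV vmin].
have uv : norm2 (r + M *m u) = norm2 (r + M *m v).
  by apply/le_anti; rewrite umin // vmin.
have midV : 2^-1 *: (u + v) \in V by rewrite memvZ // memvD.
have mid : r + M *m (2^-1 *: (u + v)) =
           2^-1 *: ((r + M *m u) + (r + M *m v)).
  rewrite -scalemxAr mulmxDr addrACA [RHS]scalerDr; congr (_ + _).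
  by rewrite -mulr2n -scaler_nat scalerA mulVf ?scale1r ?pnatr_eq0.
have := umin _ midV; rewrite mid => le_mid.
have := norm2_parallelogram (r + M *m u) (r + M *m v).
rewrite -uv -mulr2n -mulrnA => par.
have diff0 : norm2 ((r + M *m u) - (r + M *m v)) ^+ 2 <= 0.
  have le_sq : norm2 (r + M *m u) ^+ 2 <=
               norm2 (2^-1 *: ((r + M *m u) + (r + M *m v))) ^+ 2.
    by rewrite ler_sqr ?nnegrE ?norm2_ge0.
  by rewrite -(lerD2l (norm2 (r + M *m u) ^+ 2 *+ 4)) addr0 -{2}par lerD2r
             lerMn2r le_sq.
have : norm2 ((r + M *m u) - (r + M *m v)) == 0.
  by rewrite -sqrf_eq0 eq_le diff0 sqr_ge0.
rewrite norm2_eq0 subr_eq0 => /eqP/addrI Muv.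
by rewrite -[u](mulKmx hM) Muv mulKmx.
Qed.

(** * Spans and Krylov spaces *)

(** Steinitz exchange for one vector: the component of [z] on [v] is nonzero,
    so it can be solved for [v]. *)
Lemma memv_exchange (F : fieldType) (vT : vectType F) (U : {vspace vT})
    (v z : vT) :
  z \in (U + <[v]>)%VS -> z \notin U -> v \in (U + <[z]>)%VS.
Proof.
case/memv_addP=> u uU [_ /vlineP[c ->] ->] {z} zU.
have c0 : c != 0.
  by apply: contraNneq zU => ->; rewrite scale0r addr0.
have vE : v = c^-1 *: (- u) + c^-1 *: (u + c *: v).
  by rewrite -scalerDr addKr scalerA mulVf ?scale1r.
by rewrite {1}vE memv_add ?memvZ ?memvN ?memv_line.
Qed.

Lemma mem_span_mkseq (F : fieldType) (vT : vectType F) (f : nat -> vT)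
    (m : nat) (v : vT) :
  v \in <<mkseq f m>>%VS -> exists c : 'rV[F]_m, v = \sum_(i < m) c 0 i *: f i.
Proof.
pose X := [tuple f i | i < m].
have -> : mkseq f m = X by rewrite /mkseq -val_enum_ord -map_comp.
move=> vX; exists (\row_i coord X i v); rewrite [LHS](coord_span vX).
by apply: eq_bigr => i _; rewrite mxE -tnth_nth tnth_mktuple.
Qed.

Lemma krylovS (R : realType) (n : nat) (M : 'M[R]_n) (r : 'cV[R]_n) (k : nat) :
  krylov M r k.+1 = (krylov M r k + <[M ^+ k *m r]>)%VS.
Proof. by rewrite /krylov mkseqS -cats1 span_cat span_seq1. Qed.

Lemma krylov_subS (R : realType) (n : nat) (M : 'M[R]_n) (r : 'cV[R]_n)
    (k : nat) : (krylov M r k <= krylov M r k.+1)%VS.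
Proof. by rewrite krylovS addvSl. Qed.

Lemma krylov_sub (R : realType) (n : nat) (M : 'M[R]_n) (r : 'cV[R]_n)
    (j k : nat) : (j <= k)%N -> (krylov M r j <= krylov M r k)%VS.
Proof.
move=> /subnK <-; elim: (k - j)%N => // d IHd.
by rewrite addSn (subv_trans IHd) // krylov_subS.
Qed.

Lemma mem_krylov0 (R : realType) (n : nat) (M : 'M[R]_n) (r v : 'cV[R]_n) :
  (v \in krylov M r 0) = (v == 0).
Proof. by rewrite /krylov /mkseq /= span_nil memv0. Qed.

Lemma mem_krylov_pow (R : realType) (n : nat) (M : 'M[R]_n) (r : 'cV[R]_n)
    (k : nat) : M ^+ k *m r \in krylov M r k.+1.
Proof. by rewrite krylovS (subvP (addvSr _ _)) // memv_line. Qed.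

Lemma mem_krylov_start (R : realType) (n : nat) (M : 'M[R]_n) (r : 'cV[R]_n)
    (k : nat) : r \in krylov M r k.+1.
Proof.
apply: (subvP (krylov_sub M r (isT : 0 < k.+1)%N)).
by have := mem_krylov_pow M r 0; rewrite expr0 mul1mx.
Qed.

Lemma mulmx_krylov (R : realType) (n : nat) (M : 'M[R]_n) (r v : 'cV[R]_n)
    (k : nat) : v \in krylov M r k -> M *m v \in krylov M r k.+1.
Proof.
elim: k v => [|k IHk] v.
  by rewrite mem_krylov0 => /eqP->; rewrite mulmx0 mem0v.
rewrite krylovS => /memv_addP[u /IHk Mu [_ /vlineP[c ->] ->]].
rewrite mulmxDr -scalemxAr mulmxA memvD ?memvZ //.
  exact: (subvP (krylov_subS _ _ _)).
by have := mem_krylov_pow M r k.+1; rewrite exprS.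
Qed.

(** When the Krylov spaces stop growing at [k], the injective map [M] sends
    [krylov M r k] into itself, hence onto itself. *)
Lemma krylov_stable_solution (R : realType) (n : nat) (M : 'M[R]_n)
    (r : 'cV[R]_n) (k : nat) :
  M \in unitmx -> M ^+ k *m r \in krylov M r k ->
  exists2 y, y \in krylov M r k & r + M *m y = 0.
Proof.
move=> hM Mkr.
have stop : krylov M r k.+1 = krylov M r k.
  by rewrite krylovS; apply/addv_idPl; rewrite -memvE.
pose f : 'End('cV[R]_n) := linfun (mulmx M).
have fE v : f v = M *m v by rewrite lfunE.
have fK : (f @: krylov M r k)%VS = krylov M r k.
  apply/eqP; rewrite eqEdim limg_dim_eq ?leqnn ?andbT.
    apply/subvP=> _ /memv_imgP[v vK ->].
    by rewrite fE -stop mulmx_krylov.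
  apply/eqP; rewrite -subv0; apply/subvP=> v; rewrite memv_cap memv_ker fE memv0.
  by case/andP=> _ /eqP Mv; rewrite -[v](mulKmx hM) Mv mulmx0.
have : - r \in (f @: krylov M r k)%VS by rewrite fK memvN -stop mem_krylov_start.
by case/memv_imgP=> y yK; rewrite fE => ry; exists y; rewrite // -ry addrN.
Qed.

(** * Minimal residuals in Krylov spaces *)

Definition gmres_minimizer (R : realType) (n : nat) (M : 'M[R]_n)
    (r : 'cV[R]_n) (k : nat) : 'cV[R]_n -> Prop :=
  minimizes (fun y => y \in krylov M r k) (fun y => norm2 (r + M *m y)).

Lemma gmres_minimizer0 (R : realType) (n : nat) (M : 'M[R]_n) (r : 'cV[R]_n) :
  gmres_minimizer M r 0 0.
Proof. by split=> [|s]; rewrite mem_krylov0 // => /eqP->. Qed.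

Lemma gmres_step_notin (R : realType) (n : nat) (M : 'M[R]_n)
    (r y z : 'cV[R]_n) (k : nat) :
  gmres_minimizer M r k y -> norm2 (r + M *m z) < norm2 (r + M *m y) ->
  z \notin krylov M r k.
Proof. by move=> [_ ymin]; rewrite ltNge; apply: contra => /ymin. Qed.

(** If the residual were in the Krylov space, then so would be the image under
    [M] of [z], and hence, by exchange, that of the last Krylov vector; the
    space would be stable and contain an exact solution. *)
Lemma gmres_residual_notin (R : realType) (n : nat) (M : 'M[R]_n)
    (r y z : 'cV[R]_n) (k : nat) :
  M \in unitmx -> gmres_minimizer M r k y -> gmres_minimizer M r k.+1 z ->
  norm2 (r + M *m z) < norm2 (r + M *m y) -> r + M *m z != 0 ->
  r + M *m z \notin krylov M r k.+1.
Proof.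
move=> hM ymin [zK zmin] lt_zy; apply: contra => resK.
have MzK : M *m z \in krylov M r k.+1.
  by rewrite -[_ *m _](addKr r) memvD ?memvN ?mem_krylov_start.
have MkK : M ^+ k.+1 *m r \in krylov M r k.+1.
  have zNK := gmres_step_notin ymin lt_zy.
  have : z \in (krylov M r k + <[M ^+ k *m r]>)%VS by rewrite -krylovS.
  move=> /memv_exchange/(_ zNK)/memv_addP[u uK [_ /vlineP[c ->] powE]].
  have -> : M ^+ k.+1 *m r = M *m (M ^+ k *m r) by rewrite exprS mulmxA.
  by rewrite powE mulmxDr -scalemxAr memvD ?memvZ // mulmx_krylov.
have [s sK solved] := krylov_stable_solution hM MkK.
rewrite -norm2_eq0 eq_le norm2_ge0 andbT.
apply: (le_trans (zmin s sK)); rewrite solved.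
by have /eqP-> : norm2 (0 : 'cV[R]_n) == 0 by rewrite norm2_eq0.
Qed.

(** Exchange turns the Krylov basis into [z 1], ..., [z k], [r + M *m z k], one
    vector at a time; these are differences of the directions because
    [z 0 = 0]. *)
Lemma ngmres_directions_span (R : realType) (n : nat) (M : 'M[R]_n)
    (r : 'cV[R]_n) (z : nat -> 'cV[R]_n) (k : nat) :
  M \in unitmx -> z 0%N = 0 ->
  (forall j, (j <= k)%N -> gmres_minimizer M r j (z j)) ->
  (forall j, (j < k)%N ->
     norm2 (r + M *m z j.+1) < norm2 (r + M *m z j)) ->
  r + M *m z k != 0 ->
  (krylov M r k.+1 <=
    <<mkseq (fun i => z k - (r + M *m z k) - z (k - i)%N) k.+1>>)%VS.
Proof.
move=> hM z0 zmin decr rk0.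
set d := fun i => _; set U := <<_>>%VS.
have dU i : (i <= k)%N -> d i \in U.
  by move=> ik; apply: memv_span; apply: map_f; rewrite mem_iota ltnS.
have zU j : (j <= k)%N -> z j \in U.
  move=> jk; have -> : z j = d k - d (k - j)%N.
    by rewrite /d subnn z0 subr0 subKn // subKr.
  by rewrite memvB ?dU ?leq_subr.
have rU : r + M *m z k \in U.
  have -> : r + M *m z k = - d 0%N by rewrite /d subn0 addrAC addrN add0r opprK.
  by rewrite memvN dU.
have grow j v : (krylov M r j <= U)%VS -> v \in krylov M r j.+1 ->
    v \notin krylov M r j -> v \in U -> (krylov M r j.+1 <= U)%VS.
  rewrite krylovS => KU /memv_exchange exch /exch powU vU.
  rewrite subv_add KU -memvE; apply: (subvP _ _ powU).
  by rewrite subv_add KU -memvE.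
have KU j : (j <= k)%N -> (krylov M r j <= U)%VS.
  elim: j => [_|j IHj jk].
    by apply/subvP=> v; rewrite mem_krylov0 => /eqP->; rewrite mem0v.
  apply: (grow _ (z j.+1)); rewrite ?IHj ?zU // ?(ltnW jk) //.
    by have [] := zmin _ jk.
  by apply: gmres_step_notin (zmin j (ltnW jk)) (decr j jk).
apply: (grow _ (r + M *m z k)); rewrite ?KU //.
  by rewrite memvD ?mem_krylov_start ?mulmx_krylov //; have [] := zmin k (leqnn k).
case: k {d U dU zU rU grow KU} zmin decr rk0 => [|k] zmin decr rk0.
  by rewrite mem_krylov0.
exact: gmres_residual_notin (zmin k (leqnSn k)) (zmin _ (leqnn _))
  (decr k (ltnSn k)) rk0.
Qed.

(** * Both methods in preconditioned coordinates *)

Lemma residual_shift (R : realType) (n : nat) (A P : 'M[R]_n)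
    (b x0 z : 'cV[R]_n) :
  residual A b (x0 + P *m z) = residual A b x0 + A *m P *m z.
Proof. by rewrite /residual mulmxDr mulmxA addrAC. Qed.

Lemma richardson_shift (R : realType) (n : nat) (A P : 'M[R]_n)
    (b x0 z : 'cV[R]_n) :
  richardson A P b (x0 + P *m z) =
  x0 + P *m (z - (residual A b x0 + A *m P *m z)).
Proof.
rewrite /richardson -residual_shift -addrA -mulmxDr; congr (_ + P *m (_ + _)).
by rewrite /residual opprB.
Qed.

Lemma right_GMRES_coord (R : realType) (n : nat) (A P : 'M[R]_n)
    (b x0 : 'cV[R]_n) (x : nat -> 'cV[R]_n) :
  P \in unitmx -> right_GMRES A P b x0 x ->
  exists z : nat -> 'cV[R]_n,
    [/\ z 0%N = 0, forall k, x k = x0 + P *m z k &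
        forall k, gmres_minimizer (A *m P) (residual A b x0) k (z k)].
Proof.
move=> hP [x00 step]; exists (fun k => invmx P *m (x k - x0)); split.
- by rewrite x00 subrr mulmx0.
- by move=> k; rewrite mulKVmx // addrC subrK.
case=> [|k]; first by rewrite x00 subrr mulmx0; exact: gmres_minimizer0.
have [z [zmin ->]] := step k.+1 isT.
by rewrite [x0 + _]addrC addrK mulKmx.
Qed.

(** In coordinates, one NGMRES step searches [w + span (w - z (k - i))], which
    is the whole next Krylov space as soon as it contains [w] and is spanned by
    the directions; GMRES minimizes the same function there. *)
Lemma ngmres_step_gmres (R : realType) (n : nat) (A P : 'M[R]_n)
    (b x0 : 'cV[R]_n) (z : nat -> 'cV[R]_n) (x : nat -> 'cV[R]_n)
    (k : nat) (beta : 'rV[R]_k.+1) :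
  let M := A *m P in let r := residual A b x0 in
  let q := richardson A P b in
  (forall j, (j <= k)%N -> x j = x0 + P *m z j) ->
  (forall j, (j <= k)%N -> z j \in krylov M r j) ->
  (krylov M r k.+1 <=
    <<mkseq (fun i => z k - (r + M *m z k) - z (k - i)%N) k.+1>>)%VS ->
  minimizes (fun=> True)
    (fun c : 'rV[R]_k.+1 =>
       norm2 (residual A b (q (x k)) +
         \sum_(i < k.+1) c 0 i *:
           (residual A b (q (x k)) - residual A b (x (k - i)%N))) ^+ 2)
    beta ->
  exists2 y, gmres_minimizer M r k.+1 y &
    q (x k) + \sum_(i < k.+1) beta 0 i *: (q (x k) - x (k - i)%N) =
    x0 + P *m y.
Proof.
move=> M r q xE zK dirs [_ bmin].
pose w : 'cV[R]_n := z k - (r + M *m z k).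
have qE : q (x k) = x0 + P *m w by rewrite /q xE // richardson_shift.
have zKS j : (j <= k)%N -> z j \in krylov M r k.+1.
  by move=> jk; apply: (subvP (krylov_sub M r (leqW jk))); apply: zK.
have wK : w \in krylov M r k.+1.
  by rewrite memvB ?zKS // memvD ?mem_krylov_start ?mulmx_krylov ?zK.
rewrite -/w in dirs; clearbody w.
pose y (c : 'rV[R]_k.+1) : 'cV[R]_n :=
  w + \sum_(i < k.+1) c 0 i *: (w - z (k - i)%N).
have yE (c : 'rV[R]_k.+1) :
    q (x k) + \sum_(i < k.+1) c 0 i *: (q (x k) - x (k - i)%N) =
    x0 + P *m y c.
  rewrite qE /y mulmxDr addrA mulmx_sumr; congr (_ + _).
  apply: eq_bigr => i _; rewrite xE ?leq_subr // -scalemxAr mulmxBr.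
  by rewrite opprD addrACA subrr add0r.
have resE (c : 'rV[R]_k.+1) : residual A b (q (x k)) +
    \sum_(i < k.+1) c 0 i *:
      (residual A b (q (x k)) - residual A b (x (k - i)%N)) =
    r + M *m y c.
  rewrite qE residual_shift /y mulmxDr addrA mulmx_sumr; congr (_ + _).
  apply: eq_bigr => i _; rewrite xE ?leq_subr // residual_shift.
  by rewrite -scalemxAr mulmxBr opprD addrACA subrr add0r.
exists (y beta); last exact: yE.
split=> [|s sK].
  rewrite memvD // memv_suml // => i _.
  by rewrite memvZ // memvB ?zKS ?leq_subr.
have /(subvP dirs)/mem_span_mkseq[c sE] : s - w \in krylov M r k.+1.
  by rewrite memvB.
have -> : s = y c by rewrite /y -sE addrC subrK.
by have := bmin c I; rewrite !resE ler_sqr ?nnegrE ?norm2_ge0.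
Qed.

Theorem theorem2p3 (R : realType) (n : nat) (A P : 'M[R]_n)
    (b x0 : 'cV[R]_n) (x xGr : nat -> 'cV[R]_n) (kstar : nat)
    (hA : A \in unitmx) (hP : P \in unitmx)
    (hx : full_NGMRES (residual A b) (richardson A P b) x0 x)
    (hxGr : right_GMRES A P b x0 xGr)
    (hkstar : (0 < kstar)%N)
    (hnz : residual A b (xGr kstar.-1) <> 0)
    (hdecr : forall k : nat, (0 < k < kstar)%N ->
       norm2 (residual A b (xGr k)) < norm2 (residual A b (xGr k.-1))) :
  forall k : nat, (k <= kstar)%N -> x k = xGr k.
Proof.
have hM : A *m P \in unitmx by rewrite unitmx_mul hA.
have [z [z0 xGrE zmin]] := right_GMRES_coord hP hxGr.
have resE k : residual A b (xGr k) = residual A b x0 + A *m P *m z k.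
  by rewrite xGrE residual_shift.
have decr k : (k.+1 < kstar)%N ->
    norm2 (residual A b x0 + A *m P *m z k.+1) <
    norm2 (residual A b x0 + A *m P *m z k).
  by move=> kk; have := hdecr k.+1 kk; rewrite !resE.
(* For [k < kstar.-1] the norm still drops at the next step, so it is
   positive; the remaining index is the one covered by [hnz]. *)
have res_neq0 k : (k < kstar)%N -> residual A b x0 + A *m P *m z k != 0.
  move=> kk; have [kk'|kk'] := ltnP k.+1 kstar.
    by rewrite -norm2_eq0 gt_eqF // (le_lt_trans (norm2_ge0 _) (decr k kk')).
  suff -> : k = kstar.-1 by rewrite -resE; apply/eqP.
  by rewrite (_ : kstar = k.+1) //; apply/eqP; rewrite eqn_leq kk' kk.
elim/ltn_ind=> -[_ _|k IHk kk]; first by rewrite hx.1 hxGr.1.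
have [beta [bmin ->]] := hx.2 k.
have dirs := @ngmres_directions_span R n _ _ z k hM z0 (fun j _ => zmin j)
  (fun j jk => decr j (leq_ltn_trans jk kk)) (res_neq0 k kk).
have xE j : (j <= k)%N -> x j = x0 + P *m z j.
  by move=> jk; rewrite -xGrE IHk // (leq_trans jk (ltnW kk)).
have [y ymin ->] := ngmres_step_gmres xE (fun j _ => (zmin j).1) dirs bmin.
by rewrite xGrE (residual_minimizer_uniq hM ymin (zmin k.+1)).
Qed.
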